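(* Let $q\geq 0$ be a real number. For every $n\geq 1$, the poset $\mathbb{W}_n^q=(\mathcal{W}_n^q,\leq)$ is a lattice.
   Context: For a real $q\geq 0$, a $q$-decreasing word of length $n$ is a binary word of length $n$ in which every maximal factor of the form $0^a1^b$ satisfies either $a=0$ or $q\cdot a>b$. $\mathcal{W}_n^q$ denotes the set of $q$-decreasing words of length $n$. It is ordered componentwise: for $v=v_1\ldots v_n$, $w=w_1\ldots w_n$, $v\leq w$ iff $v_i\leq w_i$ for all $i$. *)

(* Defs.v *)
From HB Require Import structures.
From mathcomp Require Import all_boot all_order all_algebra.
From mathcomp Require Import boolp classical_sets reals.

Set Implicit Arguments.
Unset Strict Implicit.
Unset Printing Implicit Defensive.

Import Order.TTheory GRing.Theory Num.Theory.
Local Open Scope classical_set_scope.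
Local Open Scope ring_scope.

(* The letter 0 is [false] and the letter 1 is [true]. *)
Definition block (a b : nat) : seq bool := nseq a false ++ nseq b true.

(* [u] and [v] are the parts of [w] before and after the factor 0^a 1^b; it is
   maximal when no other factor of this form extends it on either side. *)
Definition maximal_block (w u : seq bool) (a b : nat) (v : seq bool) : Prop :=
  w = u ++ block a b ++ v /\
  forall (u' : seq bool) (a' b' : nat) (v' : seq bool),
    w = u' ++ block a' b' ++ v' ->
    (size u' <= size u)%N -> (size v' <= size v)%N ->
    u' = u /\ v' = v.

Definition qdecreasing (R : realType) (q : R) (w : seq bool) : Prop :=
  forall (u : seq bool) (a b : nat) (v : seq bool),
    maximal_block w u a b v -> a = 0%N \/ q * a%:R > b%:R.

(* [n.-tupleprod bool] is the type of [n]-tuples with the componentwise order,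
   and [false <= true]. *)
Record qdec_word (R : realType) (q : R) (n : nat) := QdecWord {
  qdec_val : n.-tupleprod bool;
  qdec_valP : `[< qdecreasing q qdec_val >] }.

HB.instance Definition _ (R : realType) (q : R) (n : nat) :=
  [isSub for @qdec_val R q n].
HB.instance Definition _ (R : realType) (q : R) (n : nat) :=
  [Choice of qdec_word q n by <:].
HB.instance Definition _ (R : realType) (q : R) (n : nat) :=
  [SubChoice_isSubPOrder of qdec_word q n by <: with Order.Disp tt tt].

Lemma qdec_word_leE (R : realType) (q : R) (n : nat) (v w : qdec_word q n) :
  (v <= w)%O = [forall i, tnth (val v) i ==> tnth (val w) i].
Proof.
rewrite -Order.le_val Order.TupleProdOrder.leEtprod.
by apply: eq_forallb => i; case: (tnth (val v) i); case: (tnth (val w) i).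
Qed.

Definition is_lattice (d : Order.disp_t) (T : porderType d) : Prop :=
  forall x y : T,
    infimums [set x; y] !=set0 /\ supremums [set x; y] !=set0.

(* Main.v *)
(** The q-decreasing words are closed under arbitrary bitwise conjunctions:
    if 0^a 1^b is a maximal factor of a conjunction, with a > 0, then its last
    0 is a 0 of some conjunct x, and the 0-run of x ending there is contained
    in 0^a while the 1-run of x following it contains 1^b.  Hence every set of
    words has an infimum, and the supremum of a set is the infimum of its
    upper bounds. *)
Require Import Defs.
From mathcomp Require Import all_boot all_order all_algebra.
From mathcomp Require Import boolp classical_sets reals.
From mathcomp Require Import zify.

Import Order.TTheory GRing.Theory Num.Theory.
Local Open Scope ring_scope.

(** Turns a factorization into letters at positions, so that comparing two factorizations becomes
    linear arithmetic. *)
Lemma nth_block (a b : nat) (u v : seq bool) (i : nat) :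
  nth true (u ++ block a b ++ v) i =
  if (i < size u)%N then nth true u i
  else if (i < size u + a)%N then false
  else if (i < size u + a + b)%N then true
  else nth true v (i - (size u + a + b)).
Proof.
rewrite nth_cat; case: ltnP => // le_ui.
rewrite nth_cat size_cat !size_nseq nth_cat size_nseq !nth_nseq.
have -> : (i - size u < a + b)%N = (i < size u + a + b)%N by lia.
have -> : (i - size u < a)%N = (i < size u + a)%N by lia.
case: (ltnP i (size u + a)) => [lt_i|ge_i].
  by rewrite ifT //; lia.
case: ltnP => [lt_i|ge_i2]; first by rewrite if_same.
by congr nth; lia.
Qed.

Lemma nth_block_zeros (a b : nat) (u v : seq bool) (i : nat) :
  (size u <= i < size u + a)%N -> nth true (u ++ block a b ++ v) i = false.
Proof. by case/andP=> le_i lt_i; rewrite nth_block ltnNge le_i lt_i. Qed.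

Lemma nth_block_ones (a b : nat) (u v : seq bool) (i : nat) :
  (size u + a <= i < size u + a + b)%N -> nth true (u ++ block a b ++ v) i.
Proof.
move=> i_in; rewrite nth_block ifF; last by lia.
by rewrite ifF ?ifT //; lia.
Qed.

Lemma size_block (a b : nat) (u v : seq bool) :
  size (u ++ block a b ++ v) = (size u + a + b + size v)%N.
Proof. by rewrite !size_cat !size_nseq; lia. Qed.

(* Reading letters with default [true] lets [nth true w m.+1] say that a run of
   zeros ends at [m], be it before a 1 or at the end of the word. *)
Definition dominated_ones {R : realType} (q : R) (w : seq bool) : Prop :=
  forall m b : nat, (m + b < size w)%N -> ~~ nth true w m -> nth true w m.+1 ->
    (forall j, (m < j <= m + b)%N -> nth true w j) ->
  exists s : nat, [/\ (s <= m)%N, b%:R < q * (m.+1 - s)%:R &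
    forall j, (s <= j <= m)%N -> ~~ nth true w j].

(** Take for [m] the last 0 of the maximal block. By maximality the zeros found by [dominated_ones]
    stay inside the block, and [0 <= q] makes the bound monotone in their number. *)
Lemma dominated_ones_qdecreasing (R : realType) (q : R) (w : seq bool) :
  0 <= q -> dominated_ones q w -> qdecreasing q w.
Proof.
move=> q_ge0 dom u [|a] b v [def_w max_w]; [by left | right].
have szw : size w = (size u + a.+1 + b + size v)%N by rewrite def_w size_block.
have nw i : nth true w i = nth true (u ++ block a.+1 b ++ v) i by rewrite -def_w.
have [||||s [le_sm lt_b zeros]] := dom (size u + a)%N b.
- by lia.
- by rewrite nw nth_block_zeros //; lia.
- rewrite nw nth_block ifF; last by lia.
  rewrite ifF; last by lia.
  (* Without ones in the block, the letter after the zeros is the first of [v]. If [v] is empty it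
     reads as the default [true]; if it were a 0, the zeros could be extended to the right. *)
  case: ltnP => // le_b; have b0 : b = 0%N by lia.
  have -> : ((size u + a).+1 - (size u + a.+1 + b) = 0)%N by lia.
  case: v max_w def_w {nw szw le_b} => //= -[] // v max_w def_w.
  have [|||_ /(congr1 size) /=] := max_w u a.+2 0%N v => //; last by lia.
  by rewrite def_w b0 /block !cats0 -[a.+2]addn1 nseqD -catA.
- by move=> j j_in; rewrite nw nth_block_ones //; lia.
apply: lt_le_trans lt_b _; apply: ler_wpM2l => //; rewrite ler_nat.
suff : (size u <= s)%N by lia.
(* Otherwise the last letter of [u] is a 0 and can be absorbed into the block. *)
rewrite leqNgt; apply/negP => lt_su.
case/lastP: u => [|u c] in def_w max_w szw nw le_sm zeros lt_su * => //.
have := zeros (size u); rewrite size_rcons in lt_su le_sm zeros *.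
move=> /(_ ltac:(lia)); rewrite nw nth_block size_rcons leqnn.
rewrite nth_rcons ltnn eqxx => /negPf c0.
have [|||/(congr1 size)] := max_w u a.+2 b v => //.
- by rewrite def_w c0 -cats1 -catA.
- by rewrite size_rcons.
by rewrite size_rcons; lia.
Qed.

(** Extending the zeros ending at [m] and the ones after them as far as possible yields a maximal
    block, which has at least [b] ones. *)
Lemma qdecreasing_dominated_ones (R : realType) (q : R) (w : seq bool) :
  qdecreasing q w -> dominated_ones q w.
Proof.
move=> dec m b lt_mb wm wm1 ones.
(* Boolean forms of the run conditions, so that [ex_minnP] and [ex_maxnP] can select the extreme
   ends; [e] is exclusive. *)
pose zeros s := all (fun j => ~~ nth true w j) (index_iota s m.+1).
pose all1 e := (e <= size w)%N && all (nth true w) (index_iota m.+1 e).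
have zerosP s : reflect (forall j, (s <= j <= m)%N -> ~~ nth true w j) (zeros s).
  by apply: (iffP allP) => H j; have := H j; rewrite mem_index_iota ltnS.
have all1P e : reflect ((e <= size w)%N /\ forall j, (m < j < e)%N -> nth true w j)
    (all1 e).
  apply: (iffP andP) => -[-> H]; split=> //; [move/allP: H => H | apply/allP];
    by move=> j; have := H j; rewrite mem_index_iota.
have [s /zerosP zs s_min] : exists2 s, zeros s & forall t, zeros t -> (s <= t)%N.
  have exz : exists s, zeros s.
    by exists m; apply/zerosP => j; rewrite -eqn_leq => /eqP <-.
  by case: (ex_minnP exz) => s; exists s.
have le_sm : (s <= m)%N.
  by apply: s_min; apply/zerosP => j; rewrite -eqn_leq => /eqP <-.
have all1b : all1 (m + b).+1 by apply/all1P; split.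
have [e /all1P[le_ew ones_e] e_max] :
    exists2 e, all1 e & forall t, all1 t -> (t <= e)%N.
  have [||e] := @ex_maxnP all1 (size w); [by exists (m + b).+1 | | by exists e].
  by move=> t /andP[].
have lt_be := e_max _ all1b.
exists s; split=> //.
have size_take_s : size (take s w) = s by rewrite size_takel //; lia.
case: (dec (take s w) (m.+1 - s)%N (e - m.+1)%N (drop e w)); last 2 first.
- by lia.
- by apply: le_lt_trans; rewrite ler_nat; lia.
have def_w : w = take s w ++ block (m.+1 - s) (e - m.+1) ++ drop e w.
  apply: (@eq_from_nth _ true) => [|i lt_iw].
    by rewrite size_block size_take_s size_drop; lia.
  rewrite nth_block size_take_s; case: ltnP => [lt_is|le_si].
    by rewrite nth_take.
  case: ltnP => [lt_i|ge_i]; first by apply: negbTE; apply: zs; lia.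
  case: ltnP => [lt_i|ge_i2]; first by apply: ones_e; lia.
  by rewrite nth_drop; congr nth; lia.
split=> // u a b' v def_w' le_u le_v.
rewrite size_take_s in le_u; rewrite size_drop in le_v.
have szw : size w = (size u + a + b' + size v)%N by rewrite def_w' size_block.
have nw i : nth true w i = nth true (u ++ block a b' ++ v) i by rewrite -def_w'.
(* Any competing factor covers positions [s] to [e - 1]. The 0 at [m] and the 1 (or end of word)
   after it force its zeros to stop exactly at [m]; the extremal choices of [s] and [e] then fix
   both ends. *)
have lt_ma : (m < size u + a)%N.
  rewrite ltnNge; apply/negP => le_am.
  by move: wm; rewrite nw nth_block_ones //; lia.
have eq_u : size u = s.
  apply/eqP; rewrite eqn_leq le_u s_min //; apply/zerosP => j j_in.
  by rewrite nw nth_block_zeros //; lia.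
have eq_a : (size u + a = m.+1)%N.
  apply/eqP; rewrite eqn_leq lt_ma andbT leqNgt; apply/negP => lt_a.
  by move: wm1; rewrite nw nth_block_zeros //; lia.
have eq_v : (size w - size v)%N = e.
  suff : (size w - size v <= e)%N by lia.
  apply: e_max; apply/all1P; split=> [|j j_in]; first by lia.
  by rewrite nw nth_block_ones //; lia.
split; first by rewrite def_w' -eq_u take_size_cat.
have -> : e = size (u ++ block a b') by rewrite !size_cat !size_nseq; lia.
by rewrite def_w' catA drop_size_cat.
Qed.

Section Infimum.
Variables (R : realType) (q : R) (n : nat).
Hypothesis q_ge0 : 0 <= q.
Implicit Types (S : set (qdec_word q n)) (x y : qdec_word q n).

Lemma qdec_word_le_nth x y :
  (x <= y)%O <-> forall i, nth true (val x) i -> nth true (val y) i.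
Proof.
rewrite qdec_word_leE; split=> [/forallP le_xy i|le_xy].
  have [lt_in|le_ni] := ltnP i n; last first.
    by move=> _; rewrite nth_default // size_tuple.
  by have /implyP := le_xy (Ordinal lt_in); rewrite !(tnth_nth true).
by apply/forallP => i; apply/implyP; rewrite !(tnth_nth true); apply: le_xy.
Qed.

(** [S] is arbitrary, so each letter is decided classically; the empty set gives the all-ones
    word. *)
Definition bigand S : n.-tuple bool :=
  [tuple `[< forall x, S x -> tnth (val x) i >] | i < n].

Lemma nth_bigand S i :
  nth true (bigand S) i <-> forall x, S x -> nth true (val x) i.
Proof.
have [lt_in|le_ni] := ltnP i n; last first.
  rewrite nth_default ?size_tuple //; split=> // _ x _.
  by rewrite nth_default ?size_tuple.
rewrite -[i]/(nat_of_ord (Ordinal lt_in)) -tnth_nth tnth_mktuple.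
by split=> [/asboolP and_i|and_i]; [|apply/asboolP] => x /and_i;
  rewrite (tnth_nth true).
Qed.

(** Through [dominated_ones] no maximal block has to be located in a conjunct: the same [m], [b] and
    [s] serve for [x] and for the conjunction. *)
Lemma qdecreasing_bigand S : qdecreasing q (bigand S).
Proof.
apply: dominated_ones_qdecreasing => // m b lt_mb and_m and_m1 ones.
have [x [Sx xm]] : exists x, S x /\ ~~ nth true (val x) m.
  apply: contrapT => no_x; move/negP: and_m; apply; apply/nth_bigand => x Sx.
  by apply: contrapT => /negP xm; apply: no_x; exists x.
have /asboolP/qdecreasing_dominated_ones dom := qdec_valP x.
have [|||s [le_sm lt_b zeros]] := dom m b _ xm.
- by move: lt_mb; rewrite !size_tuple.
- by move/nth_bigand: and_m1; apply.
- by move=> j /ones/nth_bigand; apply.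
exists s; split=> // j /zeros; apply: contra => /nth_bigand; exact.
Qed.

Lemma infimums_qdec_word S : (infimums S !=set0)%classic.
Proof.
exists (QdecWord (introT (asboolP _) (qdecreasing_bigand S))); split.
  move=> x Sx; apply/qdec_word_le_nth => i /nth_bigand; exact.
move=> y y_lb; apply/qdec_word_le_nth => i yi; apply/nth_bigand => x Sx.
by move/qdec_word_le_nth: (y_lb x Sx); apply.
Qed.

Lemma supremums_qdec_word S : (supremums S !=set0)%classic.
Proof.
have [z [z_lb z_max]] := infimums_qdec_word (ubound S).
(* Members of [S] are lower bounds of [ubound S], hence below its greatest lower bound [z]. *)
exists z; split; last exact: z_lb.
by move=> x Sx; apply: z_max => y; apply.
Qed.

End Infimum.

Theorem mainTheorem1 (R : realType) (q : R) (hq : 0 <= q) (n : nat)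
  (hn : (1 <= n)%N) : is_lattice (qdec_word q n).
Proof.
by move=> x y; split; [exact: infimums_qdec_word | exact: supremums_qdec_word].
Qed.
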